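(* Let $l:\mathbb R\to\mathbb R$ be nonnegative and quasiconvex with minimizer $x^*$. Let $X_a$ and $X_h$ be random variables (possibly dependent), and let $\hat X=\min\{X_a,X_h\}$. Then: (i) $\displaystyle \mathbb E[l(X_a)]-\mathbb E[l(\hat X)]=\mathbb E\big[(l(X_a)-l(X_h))\,\mathbb I(X_h\le X_a)\big].$ (ii) A sufficient condition for $\mathbb E[l(\hat X)]\le\mathbb E[l(X_a)]$ is $$\mathbb E[l(X_a)\,\mathbb I(X_a>x^*,\,X_h\le x^* )]\ \ge\ \mathbb E[l(X_h)\,\mathbb I(X_h\le x^* )].$$ (iii) A necessary condition for $\mathbb E[l(\hat X)]\le\mathbb E[l(X_a)]$ is $$\mathbb E[l(X_a)\,\mathbb I(X_a\ge x^* )]\ \ge\ \mathbb E[l(X_h)\,\mathbb I(X_h\le x^*,\,X_a>x^* )].$$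
   Context: $l$ is a loss function, $X_a$ the algorithmic decision, $X_h$ an upper bound imposed by a human analyst, and $\hat X$ the safeguarded decision. $\mathbb I(\cdot)$ denotes the indicator of an event.
   Formalization: Parts (i) and (iii) assume that the expected losses of X_a and of the safeguarded decision are not both infinite; otherwise the difference in (i) is undefined and (iii) can fail. Part (ii) needs no such assumption. *)

(* Defs.v *)
From mathcomp Require Import all_boot all_order all_algebra.
From mathcomp Require Import all_classical all_reals all_analysis.

Set Implicit Arguments.
Unset Strict Implicit.
Unset Printing Implicit Defensive.

Import Order.TTheory GRing.Theory Num.Theory.

Local Open Scope ring_scope.

Definition quasiconvex (R : realType) (l : R -> R) : Prop :=
  forall (x y t : R), 0 <= t -> t <= 1 ->
    l (t * x + (1 - t) * y) <= Num.max (l x) (l y).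

(* Uniqueness of the minimizer is not required. *)
Definition minimizer (R : realType) (l : R -> R) (xs : R) : Prop :=
  forall x : R, l xs <= l x.

Definition safeguarded (T : Type) (R : realType) (Xa Xh : T -> R) : T -> R :=
  fun w => Num.min (Xa w) (Xh w).

(* Main.v *)
(* On [Xh < Xa] the safeguarded decision is [Xh], elsewhere it is [Xa]; hence
   (i) is linearity of the expectation.  By quasiconvexity [l] decreases up to
   [xs] and increases after it, so intervening while [xs < Xh] never hurts.
   With [B := (Xh <= xs < Xa)] this gives the pointwise bounds
     l Xhat <= l Xa 1_(not B) + l Xh 1_(Xh <= xs)
     l Xhat >= l Xh 1_B + l Xa 1_(Xa < xs)
   and (ii), (iii) follow by comparing with the splittings of [E l(Xa)] along
   [B] and along [Xa < xs]. *)

Require Import Defs.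
From mathcomp Require Import all_boot all_order all_algebra.
From mathcomp Require Import all_classical all_reals all_analysis.
From mathcomp Require Import measurable_realfun ring lra.

Set Implicit Arguments.
Unset Strict Implicit.
Unset Printing Implicit Defensive.

Import Order.TTheory GRing.Theory Num.Theory.

Local Open Scope classical_set_scope.
Local Open Scope ring_scope.

(** [y] is the convex combination of [x] and [z] with weight [(z - y) / (z - x)] on [x]; if
    [z <= x], the three points coincide. *)
Lemma quasiconvex_between (R : realType) (l : R -> R) (x y z : R) :
  quasiconvex l -> x <= y -> y <= z -> l y <= Num.max (l x) (l z).
Proof.
move=> qc xy yz; have [xz|zx] := ltP x z; last first.
  have -> : y = x by lra.
  by rewrite le_max lexx.
have zx0 : 0 < z - x by lra.
have -> : y = (z - y) / (z - x) * x + (1 - (z - y) / (z - x)) * z by field; lra.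
apply: qc; first by rewrite divr_ge0 //; lra.
by rewrite ler_pdivrMr //; lra.
Qed.

(** Since [x] lies between [xs] and [y] and [l xs] is minimal, the larger of the two end values is
    [l y]. *)
Lemma quasiconvex_le_right (R : realType) (l : R -> R) (xs x y : R) :
  quasiconvex l -> minimizer l xs -> xs <= x -> x <= y -> l x <= l y.
Proof.
move=> qc lmin sx xy; apply: (le_trans (quasiconvex_between qc sx xy)).
by rewrite ge_max lmin lexx.
Qed.

Lemma quasiconvex_le_left (R : realType) (l : R -> R) (xs x y : R) :
  quasiconvex l -> minimizer l xs -> x <= y -> y <= xs -> l y <= l x.
Proof.
move=> qc lmin xy ys; apply: (le_trans (quasiconvex_between qc xy ys)).
by rewrite ge_max lmin lexx.
Qed.

(** Sublevel sets of [l] are intervals, hence Borel; their complements are the preimages of the rays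
    that generate the Borel sets. *)
Lemma quasiconvex_measurable (R : realType) (l : R -> R) :
  quasiconvex l -> measurable_fun setT l.
Proof.
move=> qc; apply: (measurability _ (RGenOInfty.measurableE R)) => //.
move=> _ [_] [r ->] <-; apply: measurableI => //.
rewrite -[X in measurable X]setCK; apply: measurableC.
apply: is_interval_measurable => x z /= hx hz y /andP[xy yz] /=.
move: hx hz; rewrite !in_itv /= !andbT => /negP hx /negP hz; apply/negP.
move: hx hz; rewrite -!leNgt => hx hz.
by apply: (le_trans (quasiconvex_between qc xy yz)); rewrite ge_max hx.
Qed.

Lemma mulr_indic_if (T : Type) (R : realType) (f : T -> R) (p : T -> Prop)
    (b : T -> bool) : (forall w, reflect (p w) (b w)) ->
  (fun w => f w * \1_[set u | p u] w) = (fun w => if b w then f w else 0).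
Proof.
move=> pb; apply/funext => w; rewrite indicE.
have -> : (w \in [set u | p u]) = b w.
  by apply/idP/idP => [/set_mem /pb|/pb pw]; rewrite ?inE.
by case: (b w); rewrite ?mulr1 ?mulr0.
Qed.

Section expectation_nonneg.
Context d (T : measurableType d) (R : realType) (P : probability T R).
Implicit Types f g : T -> R.

Lemma ge0_expectationD f g :
  measurable_fun setT f -> measurable_fun setT g ->
  (forall w, 0 <= f w) -> (forall w, 0 <= g w) ->
  ('E_P[fun w => (f w + g w)%R] = 'E_P[f] + 'E_P[g])%E.
Proof.
move=> mf mg f0 g0; rewrite unlock -ge0_integralD //.
- by move=> w _; rewrite lee_fin.
- exact/measurable_EFinP.
- by move=> w _; rewrite lee_fin.
- exact/measurable_EFinP.
Qed.

Lemma ge0_le_expectation f g :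
  measurable_fun setT f -> measurable_fun setT g ->
  (forall w, 0 <= f w) -> (forall w, f w <= g w) -> ('E_P[f] <= 'E_P[g])%E.
Proof.
move=> mf mg f0 fg; apply: expectation_le => //; last exact: aeW.
by move=> w; exact: le_trans (fg w).
Qed.

(* At most one of the two expectations may be infinite, so [expectationB],
   which asks both functions to be integrable, does not apply. *)
Lemma ge0_expectationB f g :
  measurable_fun setT f -> measurable_fun setT g ->
  (forall w, 0 <= f w) -> (forall w, 0 <= g w) ->
  ('E_P[f] +? - 'E_P[g])%E ->
  ('E_P[fun w => (f w - g w)%R] = 'E_P[f] - 'E_P[g])%E.
Proof.
move=> mf mg f0 g0.
pose h w := f w - g w.
have mh : measurable_fun setT h by exact: measurable_funB.
have hE : ('E_P[h] = 'E_P[h^\+] - 'E_P[h^\-])%E.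
  rewrite unlock [LHS]integralE; congr (_ - _)%E; apply: eq_integral => w _.
    by rewrite -[in LHS]/(EFin \o h) funerpos.
  by rewrite -[in LHS]/(EFin \o h) funerneg.
have mp := measurable_funrpos mh; have mn := measurable_funrneg mh.
have p0 w : 0 <= h^\+ w by exact: funrpos_ge0.
have n0 w : 0 <= h^\- w by exact: funrneg_ge0.
(* [h^\+ - h^\- = f - g] rearranged into sums of nonnegative functions, so that additivity holds
   even with infinite expectations. *)
have split_h : ('E_P[h^\+] + 'E_P[g] = 'E_P[h^\-] + 'E_P[f])%E.
  rewrite -!ge0_expectationD //; congr ('E_P[_])%E; apply/funext => w.
  rewrite /funrpos /funrneg /h /Num.max; case: ifPn; case: ifPn; lra.
have pf : ('E_P[h^\+] <= 'E_P[f])%E.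
  apply: ge0_le_expectation => // w.
  by rewrite /funrpos /h ge_max f0 andbT; have := g0 w; lra.
have ng : ('E_P[h^\-] <= 'E_P[g])%E.
  apply: ge0_le_expectation => // w.
  by rewrite /funrneg /h ge_max g0 andbT; have := f0 w; lra.
rewrite [LHS]hE.
have := expectation_ge0 P p0; have := expectation_ge0 P n0.
have := expectation_ge0 P f0; have := expectation_ge0 P g0.
move: split_h pf ng.
(* The two bounds pass finiteness from [f] to [h^\+] and from [g] to [h^\-], so every case with an
   infinite value is contradictory or immediate. *)
case: 'E_P[h^\+]%E => [p| |]; case: 'E_P[h^\-]%E => [n| |];
  case: 'E_P[f]%E => [a| |]; case: 'E_P[g]%E => [b| |] //=.
by move=> [e] _ _ _ _ _ _ _; congr EFin; lra.
Qed.

Lemma expectation_if_split f (b : T -> bool) :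
  measurable_fun setT f -> measurable_fun setT b -> (forall w, 0 <= f w) ->
  ('E_P[f] = 'E_P[fun w => (if b w then f w else 0)%R] +
             'E_P[fun w => (if ~~ b w then f w else 0)%R])%E.
Proof.
move=> mf mb f0; rewrite -ge0_expectationD //.
- by congr ('E_P[_])%E; apply/funext => w; case: (b w); rewrite ?addr0 ?add0r.
- exact: measurable_fun_ifT.
- by apply: measurable_fun_ifT => //; exact: measurable_neg.
- by move=> w; case: ifP.
- by move=> w; case: ifP.
Qed.

End expectation_nonneg.

(* Expectations are valued in the extended reals; [x +? - y] says that the
   difference x - y is not of the form oo - oo, i.e. here that the expected
   losses of Xa and of the safeguarded decision are not both infinite. *)
Theorem proposition1 (d : measure_display) (T : measurableType d)
    (R : realType) (P : probability T R)
    (l : R -> R) (xs : R) (Xa Xh : {RV P >-> R})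
    (l_ge0 : forall x : R, 0 <= l x)
    (l_qc : quasiconvex l)
    (l_min : minimizer l xs) :
  let Xhat := safeguarded Xa Xh in
  let risk_a : \bar R := ('E_P[fun w => l (Xa w)])%E in
  let risk_hat : \bar R := ('E_P[fun w => l (Xhat w)])%E in
  [/\ (risk_a +? - risk_hat)%E ->
      (risk_a - risk_hat)%E =
        ('E_P[(fun w => (l (Xa w) - l (Xh w))
                        * \1_[set u | Xh u <= Xa u] w)%R])%E,
      ('E_P[(fun w => l (Xa w)
                      * \1_[set u | xs < Xa u /\ Xh u <= xs] w)%R]
         >= 'E_P[(fun w => l (Xh w) * \1_[set u | Xh u <= xs] w)%R])%E ->
      (risk_hat <= risk_a)%E
    & (risk_a +? - risk_hat)%E ->
      (risk_hat <= risk_a)%E ->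
      ('E_P[(fun w => l (Xa w) * \1_[set u | xs <= Xa u] w)%R]
         >= 'E_P[(fun w => l (Xh w)
                      * \1_[set u | Xh u <= xs /\ xs < Xa u] w)%R])%E].
Proof.
move=> Xhat risk_a risk_hat.
have ml := quasiconvex_measurable l_qc.
have mXa : measurable_fun setT Xa by [].
have mXh : measurable_fun setT Xh by [].
have mxs : measurable_fun setT (fun _ : T => xs) by exact: measurable_cst.
have mla : measurable_fun setT (fun w => l (Xa w)).
  exact: (measurableT_comp ml mXa).
have mlh : measurable_fun setT (fun w => l (Xh w)).
  exact: (measurableT_comp ml mXh).
have mXhat : measurable_fun setT Xhat by exact: measurable_minr.
have mlhat : measurable_fun setT (fun w => l (Xhat w)).
  exact: (measurableT_comp ml mXhat).
have mif (f : T -> R) (b : T -> bool) : measurable_fun setT f -> measurable_fun setT b ->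
    measurable_fun setT (fun w => if b w then f w else 0).
  by move=> mf mb; exact: measurable_fun_ifT.
have right := quasiconvex_le_right l_qc l_min.
have left := quasiconvex_le_left l_qc l_min.
have hatE w : l (Xhat w) = if Xh w <= Xa w then l (Xh w) else l (Xa w).
  by rewrite /Xhat /safeguarded; case: leP => h; rewrite ?(min_idPr h) //;
    rewrite min_l // ltW.
split.
- move=> risk_def; rewrite -ge0_expectationB //.
  congr ('E_P[_])%E; apply/funext => w.
  rewrite hatE indicE.
  have -> : (w \in [set u | Xh u <= Xa u]) = (Xh w <= Xa w).
    by apply/idP/idP => [/set_mem|?]; rewrite ?inE.
  by case: ifP; rewrite ?mulr1 ?mulr0 ?subrr.
- pose b w := (xs < Xa w) && (Xh w <= xs).
  rewrite (mulr_indic_if (fun w => l (Xa w)) (b := b));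
    last by move=> w; exact: andP.
  rewrite (mulr_indic_if (fun w => l (Xh w)) (b := fun w => Xh w <= xs));
    last by move=> w; exact: idP.
  have mb : measurable_fun setT b.
    by apply: measurable_and; [exact: measurable_fun_ltr|
                               exact: measurable_fun_ler].
  have mh : measurable_fun setT (fun w => Xh w <= xs).
    exact: measurable_fun_ler.
  have mnb : measurable_fun setT (fun w => ~~ b w) by exact: measurable_neg.
  move=> suff_cond.
  rewrite /risk_a (expectation_if_split P mla mb) // addeC.
  (* The assumed inequality is spent on the part of [risk_a] where [b] holds; what remains is the
     pointwise upper bound. *)
  apply: le_trans (leeD2l _ suff_cond).
  rewrite -ge0_expectationD; [|by apply: mif|by apply: mif
    |by move=> w; case: ifP|by move=> w; case: ifP].
  apply: ge0_le_expectation => //.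
    by apply: measurable_funD; apply: mif.
  move=> w; rewrite hatE /b.
  have := l_ge0 (Xa w); have := l_ge0 (Xh w).
  (* Monotonicity decides the case [xs < Xh w <= Xa w], where the intervention moves the decision
     toward [xs]. *)
  have := @right (Xh w) (Xa w).
  have [ha|ha] := leP (Xh w) (Xa w); have [sa|sa] := ltP xs (Xa w);
    have [hs|hs] := leP (Xh w) xs => //=; lra.
- pose c w := (Xh w <= xs) && (xs < Xa w).
  rewrite (mulr_indic_if (fun w => l (Xa w)) (b := fun w => xs <= Xa w));
    last by move=> w; exact: idP.
  rewrite (mulr_indic_if (fun w => l (Xh w)) (b := c));
    last by move=> w; exact: andP.
  have mc : measurable_fun setT c.
    by apply: measurable_and; [exact: measurable_fun_ler|
                               exact: measurable_fun_ltr].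
  have ma : measurable_fun setT (fun w => xs <= Xa w).
    exact: measurable_fun_ler.
  have mna : measurable_fun setT (fun w => ~~ (xs <= Xa w)).
    exact: measurable_neg.
  have splita := expectation_if_split P mla ma (fun w => l_ge0 _).
  have lower : ('E_P[fun w => (if c w then l (Xh w) else 0)%R] +
      'E_P[fun w => (if ~~ (xs <= Xa w) then l (Xa w) else 0)%R]
      <= risk_hat)%E.
    rewrite -ge0_expectationD; [|by apply: mif|by apply: mif
      |by move=> w; case: ifP|by move=> w; case: ifP].
    apply: ge0_le_expectation => //.
    + by apply: measurable_funD; apply: mif.
    + by move=> w; rewrite addr_ge0 //; case: ifP.
    + move=> w; rewrite hatE /c.
      have := l_ge0 (Xa w); have := l_ge0 (Xh w).
      (* For [Xh w <= Xa w < xs] the intervention moves the decision away from [xs], so the loss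
         cannot drop. *)
      have := @left (Xh w) (Xa w).
      have [ha|ha] := leP (Xh w) (Xa w); have [sa|sa] := ltP xs (Xa w);
        have [hs|hs] := leP (Xh w) xs; have [s|s] := leP xs (Xa w) => //=;
        lra.
  move: splita lower; rewrite -/risk_a.
  have := expectation_ge0 P (fun w => l_ge0 (Xa w)); rewrite -/risk_a.
  set A := 'E_P[_]%E; set B := 'E_P[_]%E; set C := 'E_P[_]%E.
  have : (0 <= A)%E by apply: expectation_ge0 => w; case: ifP.
  have : (0 <= B)%E by apply: expectation_ge0 => w; case: ifP.
  have : (0 <= C)%E by apply: expectation_ge0 => w; case: ifP.
  (* The term over [Xa < xs], common to both bounds, must be cancelled. Were it infinite, [risk_a]
     and [risk_hat] would both be infinite, which definedness of their difference excludes. *)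
  move: A B C risk_a risk_hat => [a| |] [b| |] [e| |] [ra| |] [rh| |] //=.
  - by move=> _ _ _ _ [->]; rewrite -?EFinD !lee_fin; lra.
  - by move=> *; exact: leey.
Qed.
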